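(* Let $G=(N_k,T,P_k,S)$ be a context-free grammar in Dyck normal form with $|N_k|=2k+1$, where $N_k=\{S,[_1,\dots,[_k,]_1,\dots,]_k\}$ and the rules in $P_k$ with right-hand side of length two are of the form $X\to[_i\,]_i$, $1\le i\le k$, $X\in N_k$. Then the trace-language associated with $G$ is a subset of the one-sided Dyck language $D_k$ over $k$ letters.
   Context: A context-free grammar $G=(N,T,P,S)$ consists of disjoint finite sets $N$ (nonterminals) and $T$ (terminals), an axiom $S\in N$, and a finite set of productions $P\subseteq N\times(N\cup T)^*$; $L(G)\subseteq T^*$ is the generated language, and $\lambda$ denotes the empty string. $G$ is in Chomsky normal form if every rule has the form $A\to BC$ or $A\to a$ with $A,B,C\in N$, $a\in T$, where in addition the rule $S\to\lambda$ is allowed provided $S$ does not occur on the right-hand side of any rule. $G$ is in Dyck normal form if: (1) $G$ is in Chomsky normal form; (2) if $A\to a\in P$ with $A\in N$, $A\ne S$, $a\in T$, then no other rule in $P$ rewrites $A$; (3) for each $A\in N$ such that $X\to AB\in P$ (respectively $X\to BA\in P$) there is no rule in $P$ of the form $X'\to B'A$ (respectively $X'\to AB'$); that is, no nonterminal occurs both as the left and as the right symbol of right-hand sides of length two; (4) for any rules $X\to AB$ and $X'\to A'B$ in $P$ one has $A=A'$, and for any rules $X\to AB$ and $X'\to AB'$ in $P$ one has $B=B'$. Bracket notation: by (3) and (4) the nonterminals occurring on right-hand sides are grouped into pairs $(A,B)$ (those with some rule $X\to AB$); each such pair is named $([_i,]_i)$, $1\le i\le k$, so that the set of nonterminals is $N_k=\{S,[_1,\dots,[_k,]_1,\dots,]_k\}$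 and each rule is of the form $X\to[_i\,]_i$ or $Y\to t$ with $X,Y\in N_k$, $t\in T$ (or possibly $S\to\lambda$). Trace-language: let $D: S\Rightarrow u_1\Rightarrow\dots\Rightarrow u_{2n-1}=w$, $n\ge2$, be a leftmost derivation of $w\in L(G)$ (so $|w|=n$). The trace-word $t_{w,D}$ is the concatenation of the nonterminals consecutively rewritten in $D$, excluding the axiom $S$ rewritten in the first step. The trace-language of $G$ is the set of all $t_{w,D}$, for all $w\in L(G)$ with $|w|\ge 2$ and all leftmost derivations $D$ of $w$. The one-sided Dyck language $D_k$ is the language over $\{[_1,\dots,[_k,]_1,\dots,]_k\}$ generated by the context-free grammar with single nonterminal $S$ and rules $S\to[_i\,S\,]_i$, $S\to SS$, $S\to[_i\,]_i$, $1\le i\le k$ (so $\lambda\notin D_k$). *)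

(* Defs.v *)
From Stdlib Require Import Relation_Operators.
From mathcomp Require Import all_boot.

Set Implicit Arguments.
Unset Strict Implicit.
Unset Printing Implicit Defensive.

(* Using the sum type [N + T] for grammar symbols makes nonterminals and
   terminals disjoint. *)
Notation NT A := (inl A) (only parsing).
Notation Tm a := (inr a) (only parsing).

(* The finite set of productions is listed by [rules]; only membership in the
   list is ever used. *)
Record cfg (N T : finType) := CFG {
  axiom : N;
  rules : seq (N * seq (N + T))
}.

Section Grammars.
Variables N T : finType.
Implicit Types (G : cfg N T) (A B C X Y : N) (a : T) (u v : seq (N + T)).

Definition terminal_word (w : seq T) : seq (N + T) := [seq Tm a | a <- w].

Inductive step G : seq (N + T) -> seq (N + T) -> Prop :=
| Step x A r y : (A, r) \in rules G -> step G (x ++ NT A :: y) (x ++ r ++ y).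

Definition derives G : seq (N + T) -> seq (N + T) -> Prop :=
  clos_refl_trans _ (step G).

Definition language G (w : seq T) : Prop :=
  derives G [:: NT (axiom G)] (terminal_word w).

(* [lm_step G A u v]: u => v by rewriting A, the leftmost nonterminal of u. *)
Inductive lm_step G A : seq (N + T) -> seq (N + T) -> Prop :=
| LmStep (x : seq T) r y : (A, r) \in rules G ->
    lm_step G A (terminal_word x ++ NT A :: y) (terminal_word x ++ r ++ y).

(* [lm_derivation G u s v]: there is a leftmost derivation from u to v whose
   consecutively rewritten nonterminals form the word s. *)
Inductive lm_derivation G : seq (N + T) -> seq N -> seq (N + T) -> Prop :=
| LmRefl u : lm_derivation G u [::] u
| LmCons u A v s z :
    lm_step G A u v -> lm_derivation G v s z -> lm_derivation G u (A :: s) z.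

(* The leading [axiom G] is the nonterminal rewritten in the first step, which
   is not part of the trace-word t. *)
Definition trace_language G (t : seq N) : Prop :=
  exists w : seq T,
    [/\ language G w, 2 <= size w &
        lm_derivation G [:: NT (axiom G)] (axiom G :: t) (terminal_word w)].

Definition chomsky_normal_form G : Prop :=
  forall A r, (A, r) \in rules G ->
    [\/ exists B C, r = [:: NT B; NT C],
        exists a, r = [:: Tm a] |
        [/\ A = axiom G, r = [::] &
            forall B r', (B, r') \in rules G -> NT (axiom G) \notin r']].

Record dyck_normal_form G : Prop := DyckNormalForm {
  dnf_chomsky : chomsky_normal_form G;
  dnf_terminal : forall A a, A != axiom G -> (A, [:: Tm a]) \in rules G ->
    forall r, (A, r) \in rules G -> r = [:: Tm a];
  dnf_sides : forall X X' A B B', (X, [:: NT A; NT B]) \in rules G ->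
    (X', [:: NT B'; NT A]) \notin rules G;
  dnf_left : forall X X' A A' B, (X, [:: NT A; NT B]) \in rules G ->
    (X', [:: NT A'; NT B]) \in rules G -> A = A';
  dnf_right : forall X X' A B B', (X, [:: NT A; NT B]) \in rules G ->
    (X', [:: NT A; NT B']) \in rules G -> B = B'
}.

End Grammars.

(* The 2k bracket letters: [inl i] is the i-th left bracket and [inr i] the
   i-th right bracket, for i in {0, ..., k-1}. *)
Definition bracket (k : nat) : finType := ('I_k + 'I_k)%type.
Definition lbr (k : nat) (i : 'I_k) : bracket k := inl i.
Definition rbr (k : nat) (i : 'I_k) : bracket k := inr i.

(* N_k consists of S, encoded as [None], and of the bracket letters. *)
Definition Nk (k : nat) : finType := option (bracket k).
Definition Sk (k : nat) : Nk k := None.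
Definition nt_of_bracket (k : nat) (b : bracket k) : Nk k := Some b.

Lemma card_Nk (k : nat) : #|Nk k| = (2 * k).+1.
Proof. by rewrite card_option card_sum card_ord mul2n addnn. Qed.

Definition dyck_grammar (k : nat) : cfg unit (bracket k) :=
  CFG tt
    ((tt, [:: NT tt; NT tt]) ::
     [seq (tt, [:: Tm (lbr i); NT tt; Tm (rbr i)]) | i <- enum 'I_k] ++
     [seq (tt, [:: Tm (lbr i); Tm (rbr i)]) | i <- enum 'I_k]).

Definition dyck_language (k : nat) : seq (bracket k) -> Prop :=
  language (dyck_grammar k).

(* Main.v *)
Require Import Defs.
From Stdlib Require Import Relation_Operators.
From mathcomp Require Import all_boot.

Set Implicit Arguments.
Unset Strict Implicit.
Unset Printing Implicit Defensive.

(** A leftmost derivation rewrites the pending nonterminals Y_1 ... Y_n of a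
    sentential form one after the other, so its trace is Y_1 d_1 ... Y_n d_n,
    where d_i is the trace left by the descendants of Y_i.  If Y_i is rewritten
    to a terminal then d_i is empty; if it is rewritten to [_j ]_j then
    d_i = [_j d ]_j d'.  Hence every d_i is empty or a Dyck word, and the
    trace-word is the one left by the descendants of the axiom. *)

Section Derivations.
Variables (N T : finType) (G : cfg N T).

Lemma derives_step u v w : step G u v -> derives G v w -> derives G u w.
Proof. by move=> uv; apply: rt_trans; apply: rt_step. Qed.

Lemma derives_ctx x y u v : derives G u v -> derives G (x ++ u ++ y) (x ++ v ++ y).
Proof.
elim=> [_ _ [x' A r y' Ar]|u0|u0 v0 w0 _ uv _ vw]; last 2 first.
- exact: rt_refl.
- exact: rt_trans uv vw.
apply: rt_step; rewrite -!catA catA (catA x x' (r ++ _)); exact: Step.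
Qed.

Lemma derives_cat u u' v v' :
  derives G u u' -> derives G v v' -> derives G (u ++ v) (u' ++ v').
Proof.
move=> /(derives_ctx [::] v) uu' /(derives_ctx u' [::]).
by rewrite !cats0; apply: rt_trans.
Qed.

Definition nonterminals (u : seq (N + T)) : seq N :=
  pmap (fun c => if c is inl A then Some A else None) u.

Lemma nonterminals_cat u v :
  nonterminals (u ++ v) = nonterminals u ++ nonterminals v.
Proof. exact: pmap_cat. Qed.

Lemma nonterminals_terminal_word (w : seq T) :
  nonterminals (terminal_word N w) = [::].
Proof. by elim: w. Qed.

(** Seen through [nonterminals], a leftmost step acts on a stack: the terminal prefix is invisible,
    [A] is popped and the nonterminals of [r] are pushed. *)
Lemma lm_step_nonterminals A u v : lm_step G A u v ->
  exists2 r, (A, r) \in rules G & exists2 l,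
    nonterminals u = A :: l & nonterminals v = nonterminals r ++ l.
Proof.
case=> x r y Ar; exists r => //; exists (nonterminals y).
  by rewrite nonterminals_cat nonterminals_terminal_word.
by rewrite !nonterminals_cat nonterminals_terminal_word.
Qed.

Lemma lm_step1 A B v : lm_step G A [:: NT B] v -> (A, v) \in rules G.
Proof.
move eqs: [:: _] => u st; case: st eqs => -[|a [|b x]] r y Ar //= [_ <-].
by rewrite cats0.
Qed.

Lemma lm_derivation_no_nonterminals u s z :
  nonterminals u = [::] -> lm_derivation G u s z -> z = u.
Proof.
by move=> u0 d; case: d u0 => // {}u A v s' z' /lm_step_nonterminals
  [r _ [l -> _]].
Qed.

End Derivations.

Section DyckWords.
Variable k : nat.
Implicit Types (d s : seq (bracket k)) (i : 'I_k).

(** The empty word is added by hand: it is not in the Dyck language, but it is what a nonterminal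
    rewritten to a terminal leaves behind. *)
Definition dyck_or_nil d := d = [::] \/ dyck_language d.

Lemma dyck_rule_pair i :
  (tt, [:: Tm (lbr i); Tm (rbr i)]) \in rules (dyck_grammar k).
Proof.
rewrite !inE mem_cat; apply/or3P; apply: Or33.
by apply/mapP; exists i; rewrite ?mem_enum.
Qed.

Lemma dyck_rule_nest i :
  (tt, [:: Tm (lbr i); NT tt; Tm (rbr i)]) \in rules (dyck_grammar k).
Proof.
rewrite !inE mem_cat; apply/or3P; apply: Or32.
by apply/mapP; exists i; rewrite ?mem_enum.
Qed.

(** The grammar has no erasing rule, so an empty inside needs the rule for a bare pair and a
    nonempty one the nesting rule. *)
Lemma dyck_language_nest i d :
  dyck_or_nil d -> dyck_language (lbr i :: rcons d (rbr i)).
Proof.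
case=> [->|dD].
  apply: rt_step; exact: (Step [::] [::] (dyck_rule_pair i)).
apply: derives_step (Step [::] [::] (dyck_rule_nest i)) _ => /=.
rewrite /terminal_word /= map_rcons -cats1.
exact: (derives_ctx [:: Tm (lbr i)] [:: Tm (rbr i)] dD).
Qed.

Lemma dyck_language_cat d1 d2 :
  dyck_language d1 -> dyck_language d2 -> dyck_language (d1 ++ d2).
Proof.
move=> D1 D2; rewrite /dyck_language /language /terminal_word map_cat.
have ruleSS : (tt, [:: NT tt; NT tt]) \in rules (dyck_grammar k).
  by rewrite !inE eqxx.
apply: derives_step (Step [::] [::] ruleSS) _.
exact: derives_cat D1 D2.
Qed.

Lemma dyck_language_nest_cat i d1 d2 : dyck_or_nil d1 -> dyck_or_nil d2 ->
  dyck_language (lbr i :: d1 ++ rbr i :: d2).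
Proof.
rewrite -cat_rcons -cat_cons => D1 [->|D2].
  by rewrite cats0; apply: dyck_language_nest.
exact/dyck_language_cat/D2/dyck_language_nest.
Qed.

(** The first word is the stack of pending nonterminals; the second is a possible trace from it,
    each letter followed by what its descendants leave. *)
Inductive dyck_interleaved : seq (bracket k) -> seq (bracket k) -> Prop :=
| InterleavedNil : dyck_interleaved [::] [::]
| InterleavedCons b bs d s : dyck_or_nil d -> dyck_interleaved bs s ->
    dyck_interleaved (b :: bs) (b :: d ++ s).

Lemma dyck_interleaved_consE b bs s : dyck_interleaved (b :: bs) s ->
  exists d s', [/\ s = b :: d ++ s', dyck_or_nil d & dyck_interleaved bs s'].
Proof.
move eqc: (b :: bs) => c h; case: h eqc => // b' bs' d s' dD h [-> ->].
by exists d, s'.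
Qed.

(** Undoes the push made by a binary rule: the two letters and the words after them merge into one
    Dyck word, ready to be charged to the parent. *)
Lemma dyck_interleaved_pairE i bs s :
  dyck_interleaved (lbr i :: rbr i :: bs) s ->
  exists d s', [/\ s = d ++ s', dyck_language d & dyck_interleaved bs s'].
Proof.
move=> /dyck_interleaved_consE [d1 [s1 [-> D1]]].
move=> /dyck_interleaved_consE [d2 [s' [-> D2 h]]].
exists (lbr i :: d1 ++ rbr i :: d2), s'; split=> //.
  by rewrite /= -catA.
exact: dyck_language_nest_cat.
Qed.

End DyckWords.

(** By induction on the derivation; [bs] stays universally quantified because the stack changes at
    each step. *)
Lemma lm_derivation_interleaved (k : nat) (T : finType) (G : cfg (Nk k) T)
    (hC : chomsky_normal_form G)
    (hP : forall X Y Z : Nk k, (X, [:: NT Y; NT Z]) \in rules G ->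
       exists i : 'I_k,
         Y = nt_of_bracket (lbr i) /\ Z = nt_of_bracket (rbr i)) u s z :
  lm_derivation G u s z -> nonterminals z = [::] ->
  forall bs, nonterminals u = [seq nt_of_bracket b | b <- bs] ->
  exists2 s', dyck_interleaved bs s' & s = [seq nt_of_bracket b | b <- s'].
Proof.
elim=> [{}u -> [|//] _ | {}u A v {}s {}z st _ IH z0 [|b bs]].
- by exists [::] => //; constructor.
- by have [r _ [l -> _]] := lm_step_nonterminals st.
have [r Ar [l -> vE]] := lm_step_nonterminals st.
case=> Ab lE; rewrite {}lE in vE.
(* Common to the terminal and the erasing rules: nothing is pushed, so [b] gets the empty word. *)
have leaf : nonterminals r = [::] ->
    exists2 s', dyck_interleaved (b :: bs) s' &
      A :: s = [seq nt_of_bracket b | b <- s'].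
  move=> r0; have [|s' bs_s' ->] := IH z0 bs; first by rewrite vE r0.
  exists (b :: [::] ++ s'); last by rewrite /= Ab.
  by constructor=> //; left.
have [[B [C rE]]|[a rE]|[_ rE _]] := hC _ _ Ar; try by apply: leaf; rewrite rE.
move: Ar vE; rewrite rE => /hP [i [-> ->]] vE.
(* The new pair sits on top of the old stack; its trace becomes the word of descendants of [b]. *)
have [s' h ->] := IH z0 (lbr i :: rbr i :: bs) vE.
have [d [s'' [-> D h']]] := dyck_interleaved_pairE h.
exists (b :: d ++ s''); last by rewrite /= Ab.
by constructor=> //; right.
Qed.

Theorem theorem2p8 (k : nat) (T : finType) (G : cfg (Nk k) T)
    (hS : axiom G = Sk k)
    (hD : dyck_normal_form G)
    (hP : forall X Y Z : Nk k, (X, [:: NT Y; NT Z]) \in rules G ->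
       exists i : 'I_k,
         Y = nt_of_bracket (lbr i) /\ Z = nt_of_bracket (rbr i)) :
  forall t : seq (Nk k), trace_language G t ->
    exists2 u : seq (bracket k),
      dyck_language u & t = [seq nt_of_bracket b | b <- u].
Proof.
move=> t [w [_ w2 dw]]; have hC := dnf_chomsky hD.
(* The first step is split off: the trace omits it, and the axiom is not a bracket. *)
have [v st dv] : exists2 v, lm_step G (axiom G) [:: NT (axiom G)] v &
    lm_derivation G v t (terminal_word _ w).
  by inversion dw; exists v.
have Sv := lm_step1 st.
(* A first rule without nonterminals ends the derivation at a word of length at most one, against
   [w2]. *)
have leaf : nonterminals v = [::] -> size v = size w.
  move=> v0; rewrite -(lm_derivation_no_nonterminals v0 dv).
  by rewrite /terminal_word size_map.
have [[B [C vE]]|[a vE]|[_ vE _]] := hC _ _ Sv; last 2 first.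
- by rewrite -leaf vE in w2.
- by rewrite -leaf vE in w2.
move: Sv dv; rewrite vE => /hP [i [-> ->]] dv.
have [s h ->] := lm_derivation_interleaved hC hP dv
  (nonterminals_terminal_word _ _) (bs := [:: lbr i; rbr i]) erefl.
have [d [s' [-> D h']]] := dyck_interleaved_pairE h.
(* Below the initial pair the stack is empty, which forces [s'] to be empty. *)
by exists d; inversion h'; rewrite ?cats0.
Qed.
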